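(* Let $p$ be a program of the split fireball calculus and let $\pi \triangleright \Gamma \vdash p : \mathbf 0$ be a tight type derivation. Then there is a normalising evaluation $d : p \to_{\beta_f}^* q$ (with $q$ normal) such that $|\pi| = |d| + |q| = |d| + |\Gamma|$. In particular, if $\mathrm{dom}(\Gamma)=\emptyset$, then $|\pi| = |d|$ and $q$ is a coerced value.
   Context: Terms: $t,u ::= x \mid \lambda x.t \mid tu$, up to $\alpha$-equivalence; $t\{x\leftarrow u\}$ is capture-avoiding substitution. Values: $v ::= x \mid \lambda x.t$. Fireballs $f$ and inert terms $i$ are defined by mutual induction: $f ::= v \mid i$ and $i ::= x f_1 \dots f_n$ with $n>0$ (application left-associative). Right evaluation contexts: $C ::= \langle\cdot\rangle \mid t\,C \mid C\,f$. Split fireball calculus: environments $E ::= \epsilon \mid [x\leftarrow i]:E$; programs are pairs $p=(t,E)$; a coerced value is a program $(v,\epsilon)$. Reduction: $(C\langle(\lambda x.t)v\rangle,E)\to_{\beta_v}(C\langle t\{x\leftarrow v\}\rangle,E)$ and $(C\langle(\lambda x.t)i\rangle,E)\to_{\beta_i}(C\langle t\rangle,[x\leftarrow i]:E)$; $\to_{\beta_f}=\to_{\beta_v}\cup\to_{\beta_i}$. A program is normal if it has no $\to_{\beta_f}$-reduct. $|d|$ is the number of steps of an evaluation $d$. Append: $\epsilon@[x\leftarrow i]=[x\leftarrow i]$, $([y\leftarrow i']:E)@[x\leftarrow i]=[y\leftarrow i']:(E@[x\leftarrow i])$. Sizes: $|v|=0$, $|tu|=|t|+|u|+1$, $|(t,\epsilon)|=|t|$,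 $|(t,E@[x\leftarrow i])|=|(t,E)|+|i|$. Multi types: linear types $L ::= M\multimap N$; multi types $M,N ::= [L_1,\dots,L_n]$ (finite multisets, $n\ge 0$); $\mathbf 0$ is the empty multiset, $\uplus$ multiset sum. Type context $\Gamma$: total map from variables to multi types with finite $\mathrm{dom}(\Gamma)=\{x\mid \Gamma(x)\ne\mathbf 0\}$; $(\Gamma\uplus\Delta)(x)=\Gamma(x)\uplus\Delta(x)$; $x:M$ maps $x$ to $M$ and all else to $\mathbf 0$; $\Gamma,x:M$ extends $\Gamma$ ($x\notin\mathrm{dom}(\Gamma)$) by $x\mapsto M$. Typing rules: (ax) $x:M\vdash x:M$; (@) from $\Gamma\vdash t:[M\multimap N]$ and $\Delta\vdash u:M$ infer $\Gamma\uplus\Delta\vdash tu:N$; ($\lambda$) from $\Gamma_k,x:M_k\vdash t:N_k$ for $k=1,\dots,n$ ($n\ge0$) infer $\Gamma_1\uplus\dots\uplus\Gamma_n\vdash\lambda x.t:[M_1\multimap N_1,\dots,M_n\multimap N_n]$; (es$_\epsilon$) from $\Gamma\vdash t:M$ infer $\Gamma\vdash (t,\epsilon):M$; (es$_@$) from $\Gamma,x:M\vdash(t,E):N$ and $\Delta\vdash i:M$ infer $\Gamma\uplus\Delta\vdash(t,E@[x\leftarrow i]):N$. $|\pi|$ is the number of (@) rules in $\pi$. Type sizes: $|M\multimap N|=1+|M|+|N|$, $|[L_1,\dots,L_n]|=\sum_k|L_k|$, and for a context $|\Gamma|=\sum_x|\Gamma(x)|$. Inert multi types are defined inductively as finite multisets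 of linear types of the form $\mathbf 0\multimap N$ with $N$ inert (so $\mathbf 0$ is inert); a context is inert if all its values are inert. A derivation $\pi\triangleright\Gamma\vdash e:M$ is inert if $\Gamma$ and $M$ are inert, and tight if it is inert and $M=\mathbf 0$. *)

(* Defs.v *)
From Stdlib Require List.
From HB Require Import structures.
From mathcomp Require Import all_boot.
From mathcomp Require Import finmap multiset.

Set Implicit Arguments.
Unset Strict Implicit.
Unset Printing Implicit Defensive.

Local Open Scope fset_scope.
Local Open Scope mset_scope.
Local Open Scope nat_scope.

(* Terms up to alpha-equivalence are represented with de Bruijn indices; the
   free variables of a term are the indices exceeding its binding depth. *)
Inductive term : Type :=
| Var of nat
| Lam of term
| App of term & term.

(* [bump k] is the order embedding of nat missing k, [unbump k] its inverse. *)
Fixpoint tshift (k : nat) (t : term) : term :=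
  match t with
  | Var x => Var (bump k x)
  | Lam t1 => Lam (tshift k.+1 t1)
  | App t1 t2 => App (tshift k t1) (tshift k t2)
  end.

(* Capture-avoiding substitution of u for the index k, which disappears. *)
Fixpoint tsubst (k : nat) (u t : term) : term :=
  match t with
  | Var x => if x == k then u else Var (unbump k x)
  | Lam t1 => Lam (tsubst k.+1 (tshift 0 u) t1)
  | App t1 t2 => App (tsubst k u t1) (tsubst k u t2)
  end.

Inductive value : term -> Prop :=
| value_var x : value (Var x)
| value_lam t : value (Lam t).

(* The inert term x f_1 ... f_n with n > 0 is spelled x f fs. *)
Inductive fireball : term -> Prop :=
| fireball_value v : value v -> fireball v
| fireball_inert i : inert i -> fireball i
with inert : term -> Prop :=
| inert_app x f fs :
    fireball f -> (forall g, List.In g fs -> fireball g) ->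
    inert (foldl App (App (Var x) f) fs).

Inductive ectx : Type :=
| Hole
| AppR of term & ectx
| AppL of ectx & term.

Inductive right_ctx : ectx -> Prop :=
| right_hole : right_ctx Hole
| right_appR t C : right_ctx C -> right_ctx (AppR t C)
| right_appL C f : right_ctx C -> fireball f -> right_ctx (AppL C f).

(* Right contexts do not go under abstractions, so plugging captures nothing. *)
Fixpoint plug (C : ectx) (t : term) : term :=
  match C with
  | Hole => t
  | AppR u C1 => App u (plug C1 t)
  | AppL C1 u => App (plug C1 t) u
  end.

Fixpoint eshift (k : nat) (C : ectx) : ectx :=
  match C with
  | Hole => Hole
  | AppR u C1 => AppR (tshift k u) (eshift k C1)
  | AppL C1 u => AppL (eshift k C1) (tshift k u)
  end.

(* (t, [:: i_1; ...; i_n]) stands for (t, [x_1 <- i_1] : ... : [x_n <- i_n]).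
   The entry [x_k <- i_k] binds x_k in t and in i_1, ..., i_(k-1): in t the
   index k-1 is x_k, in i_j (j < k) it is the index k-j-1.  The free variables
   of the program are the indices of t from n on, those of i_j from n-j on. *)
Definition prog : Type := (term * seq term)%type.

Definition is_program (p : prog) : Prop :=
  forall i, List.In i p.2 -> inert i.

Definition coerced_value (p : prog) : Prop :=
  exists v, value v /\ p = (v, [::]).

Inductive step_v : prog -> prog -> Prop :=
| StepV C t v E : right_ctx C -> value v ->
    step_v (plug C (App (Lam t) v), E) (plug C (tsubst 0 v t), E).

(* The bound variable, index 0 of t, becomes the variable of the new leftmost
   entry; the surrounding context is shifted since this variable is fresh. *)
Inductive step_i : prog -> prog -> Prop :=
| StepI C t i E : right_ctx C -> inert i ->
    step_i (plug C (App (Lam t) i), E) (plug (eshift 0 C) t, i :: E).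

Definition step (p q : prog) : Prop := step_v p q \/ step_i p q.

Definition normal (p : prog) : Prop := forall q, ~ step p q.

Inductive evaluation : prog -> prog -> Type :=
| eval_nil p : evaluation p p
| eval_cons p q r : step p q -> evaluation q r -> evaluation p r.

Fixpoint eval_size p q (d : evaluation p q) : nat :=
  match d with
  | eval_nil _ => 0
  | eval_cons _ _ _ _ d1 => (eval_size d1).+1
  end.

Fixpoint term_size (t : term) : nat :=
  match t with
  | App t1 t2 => term_size t1 + term_size t2 + 1
  | _ => 0
  end.

Definition prog_size (p : prog) : nat :=
  term_size p.1 + \sum_(i <- p.2) term_size i.

(* Linear and multi types.  A raw linear type is M -o N with M and N given by
   sequences; [ltype] retains the raw types all of whose sequences, at every
   depth, are the canonical enumeration of a multiset.  Thus [mtype], the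
   finite multisets over [ltype], solves ltype ~ mtype * mtype: see [arrow],
   [ldom], [lcod], [arrowK], [larrowK] and [ltype_rect]. *)
Inductive raw : Type := Raw of seq raw & seq raw.

Section RawInd.
Variable P : raw -> Type.
Fixpoint all_raw (s : seq raw) : Type :=
  if s is a :: s1 then (P a * all_raw s1)%type else unit.
Hypothesis H : forall s t, all_raw s -> all_raw t -> P (Raw s t).
Fixpoint raw_ind_all (a : raw) : P a :=
  let: Raw s t := a in
  let fix F s : all_raw s :=
    if s is b :: s1 return all_raw s then (raw_ind_all b, F s1) else tt in
  H (F s) (F t).
End RawInd.

Fixpoint raw_enc (a : raw) : GenTree.tree unit :=
  let: Raw s t := a in
  GenTree.Node 0 [:: GenTree.Node 0 (map raw_enc s);
                     GenTree.Node 0 (map raw_enc t)].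

Fixpoint raw_dec (b : GenTree.tree unit) : raw :=
  match b with
  | GenTree.Node _ [:: GenTree.Node _ s; GenTree.Node _ t] =>
      Raw (map raw_dec s) (map raw_dec t)
  | _ => Raw [::] [::]
  end.

Lemma raw_encK : cancel raw_enc raw_dec.
Proof.
have E s : all_raw (fun a => raw_dec (raw_enc a) = a) s ->
    map raw_dec (map raw_enc s) = s.
  by elim: s => //= a s IH [-> /IH ->].
by elim/raw_ind_all => s t /E Es /E Et; rewrite /= Es Et.
Qed.

HB.instance Definition _ := Countable.copy raw (can_type raw_encK).

Definition raw_norm (s : seq raw) : seq raw := enum_mset (seq_mset s).

Fixpoint canonical_raw (a : raw) : bool :=
  let: Raw s t := a in
  [&& s == raw_norm s, t == raw_norm t, all canonical_raw s
    & all canonical_raw t].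

Record ltype : Type := LType { raw_of : raw; _ : canonical_raw raw_of }.

HB.instance Definition _ := [isSub for raw_of].
HB.instance Definition _ := [Countable of ltype by <:].

Definition mtype : Type := {mset ltype}.
HB.instance Definition _ := Countable.on mtype.

Notation mt0 := (@mset0 ltype : mtype).

Lemma raw_norm_perm s : perm_eq (raw_norm s) s.
Proof. exact: perm_eq_seq_mset. Qed.

Lemma raw_normP s t : perm_eq s t -> raw_norm s = raw_norm t.
Proof. by move=> /eq_seq_msetP; rewrite /raw_norm => ->. Qed.

Definition raw_mset (M : mtype) : seq raw :=
  raw_norm (map raw_of (enum_mset M)).

Lemma canonical_raw_mset M :
  (raw_mset M == raw_norm (raw_mset M)) && all canonical_raw (raw_mset M).
Proof.
apply/andP; split; first by apply/eqP/raw_normP; rewrite perm_sym raw_norm_perm.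
rewrite (perm_all _ (raw_norm_perm _)) all_map.
by apply/allP => L _; apply: (valP L).
Qed.

Lemma arrow_subproof (M N : mtype) :
  canonical_raw (Raw (raw_mset M) (raw_mset N)).
Proof.
have /andP[eM aM] := canonical_raw_mset M.
have /andP[eN aN] := canonical_raw_mset N.
by rewrite /= eM aM eN aN.
Qed.

Definition arrow (M N : mtype) : ltype := LType (arrow_subproof M N).

Definition mset_of_raw (s : seq raw) : mtype := seq_mset (pmap insub s).

Definition ldom (L : ltype) : mtype :=
  let: Raw s _ := raw_of L in mset_of_raw s.
Definition lcod (L : ltype) : mtype :=
  let: Raw _ t := raw_of L in mset_of_raw t.

Lemma raw_msetK : cancel raw_mset mset_of_raw.
Proof.
move=> M; rewrite /mset_of_raw /raw_mset.
have /eq_seq_msetP -> : perm_eq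
    (pmap (insub : raw -> option ltype) (raw_norm (map raw_of (enum_mset M))))
    (enum_mset M).
  rewrite -[X in perm_eq _ X](map_pK (valK : pcancel (val : ltype -> raw) _)).
  exact: perm_pmap (raw_norm_perm _).
by apply/msetP => L; rewrite -count_mem_mset (permP (perm_eq_seq_mset _))
                             count_mem_mset.
Qed.

Lemma mset_of_rawK s :
  s == raw_norm s -> all canonical_raw s -> raw_mset (mset_of_raw s) = s.
Proof.
move=> /eqP es /allP cs; rewrite {2}es; apply: raw_normP.
apply: perm_trans (perm_map _ (perm_eq_seq_mset _)) _.
rewrite (pmap_filter (@insubK _ _ ltype)) (_ : filter _ s = s) //.
by apply/all_filterP/allP => a /cs ca; rewrite /= insubT.
Qed.

Lemma arrowK M N : ldom (arrow M N) = M /\ lcod (arrow M N) = N.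
Proof. by rewrite /ldom /lcod /= !raw_msetK. Qed.

Lemma larrowK L : arrow (ldom L) (lcod L) = L.
Proof.
apply: val_inj; case: L => [[s t] cL] /=.
have /and4P[es et cs ct] := cL.
by rewrite /ldom /lcod /= !mset_of_rawK.
Qed.

Lemma arrow_inj M N M' N' : arrow M N = arrow M' N' -> M = M' /\ N = N'.
Proof.
by have [dM cN] := arrowK M N; have [dM' cN'] := arrowK M' N'; split; congruence.
Qed.

Lemma ltype_rect (P : ltype -> Type) :
  (forall M N : mtype, (forall L, L \in M -> P L) -> (forall L, L \in N -> P L) ->
     P (arrow M N)) ->
  forall L, P L.
Proof.
move=> H; suff F a : forall L, raw_of L = a -> P L by move=> L; apply: (F _ L).
elim/raw_ind_all: a => s t Fs Ft L eL; rewrite -(larrowK L).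
have G u : all_raw (fun a => forall L, raw_of L = a -> P L) u ->
    forall L', L' \in mset_of_raw u -> P L'.
  move=> Fu L'; rewrite (perm_mem (perm_eq_seq_mset _)).
  rewrite mem_pmap_sub /=; elim: u Fu => //= a u IH [Pa Pu].
  rewrite inE; case: eqVneq => [e _|_ /=]; first exact: Pa.
  exact: IH.
by apply: H; rewrite /ldom /lcod eL; apply: G.
Qed.

Fixpoint raw_size (a : raw) : nat :=
  let: Raw s t := a in 1 + sumn (map raw_size s) + sumn (map raw_size t).

Definition ltype_size (L : ltype) : nat := raw_size (raw_of L).
Definition mtype_size (M : mtype) : nat := \sum_(L <- enum_mset M) ltype_size L.

Lemma ltype_size_arrow M N :
  ltype_size (arrow M N) = 1 + mtype_size M + mtype_size N.
Proof.
have E K : sumn (map raw_size (raw_mset K)) = mtype_size K.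
  by rewrite sumn_map (perm_big _ (raw_norm_perm _)) big_map.
by rewrite /ltype_size /= !E.
Qed.

(* A finitely supported map is determined by its values, and its domain
   {x | Gamma x <> 0} is [finsupp Gamma]. *)
Definition tctx : Type := {fsfun nat -> mtype with mt0}.

Definition ctx0 : tctx := [fsfun].

Definition ctx1 (x : nat) (M : mtype) : tctx := [fsfun y in [fset x] => M].

Definition ctxD (Gamma Delta : tctx) : tctx :=
  [fsfun x in (finsupp Gamma `|` finsupp Delta)%fset =>
    (Gamma x `+` Delta x : mtype)].

(* Gamma, x : M, where the variable x is the innermost one, of index 0. *)
Definition ctx_cons (M : mtype) (Gamma : tctx) : tctx :=
  [fsfun x in (0 |` [fset y.+1 | y in finsupp Gamma])%fset =>
    (if x is y.+1 then Gamma y else M : mtype)].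

Lemma ctx0E x : ctx0 x = mt0.
Proof. by rewrite fsfunE. Qed.

Lemma ctx1E x M y : ctx1 x M y = if y == x then M else mt0.
Proof. by rewrite fsfunE inE. Qed.

Lemma ctxDE Gamma Delta x : ctxD Gamma Delta x = Gamma x `+` Delta x.
Proof.
rewrite fsfunE inE; case: ifPn => //; rewrite negb_or => /andP[gx dx].
by rewrite !fsfun_dflt // msetD0.
Qed.

Lemma ctx_consE M Gamma x :
  ctx_cons M Gamma x = if x is y.+1 then Gamma y else M.
Proof.
rewrite fsfunE; case: ifPn => //; case: x => [|x]; rewrite !inE //=.
move=> nx; rewrite fsfun_dflt //; apply: contra nx => gx.
by apply/imfsetP; exists x.
Qed.

Definition ctx_size (Gamma : tctx) : nat :=
  \sum_(x <- finsupp Gamma) mtype_size (Gamma x).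

Inductive typing : tctx -> term -> mtype -> Type :=
| ty_ax x M : typing (ctx1 x M) (Var x) M
| ty_app Gamma Delta t u M N :
    typing Gamma t [mset arrow M N] -> typing Delta u M ->
    typing (ctxD Gamma Delta) (App t u) N
| ty_lam n (Gamma : 'I_n -> tctx) t (M N : 'I_n -> mtype) :
    (forall k, typing (ctx_cons (M k) (Gamma k)) t (N k)) ->
    typing (\big[ctxD/ctx0]_(k < n) Gamma k) (Lam t)
           (\big[msetD/mt0]_(k < n) [mset arrow (M k) (N k)]).

Inductive ptyping : tctx -> prog -> mtype -> Type :=
| ty_es0 Gamma t M : typing Gamma t M -> ptyping Gamma (t, [::]) M
| ty_es Gamma Delta t E i M N :
    ptyping (ctx_cons M Gamma) (t, E) N -> typing Delta i M ->
    ptyping (ctxD Gamma Delta) (t, rcons E i) N.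

(* The size of a derivation is its number of [ty_app] rules. *)
Fixpoint typing_size Gamma t M (pi : typing Gamma t M) : nat :=
  match pi with
  | ty_ax _ _ => 0
  | ty_app _ _ _ _ _ _ pi1 pi2 => (typing_size pi1 + typing_size pi2).+1
  | ty_lam n _ _ _ _ pis => \sum_(k < n) typing_size (pis k)
  end.

Fixpoint ptyping_size Gamma p M (pi : ptyping Gamma p M) : nat :=
  match pi with
  | ty_es0 _ _ _ pi1 => typing_size pi1
  | ty_es _ _ _ _ _ _ _ pi1 pi2 => ptyping_size pi1 + typing_size pi2
  end.

Inductive inert_ltype : ltype -> Prop :=
| inert_arrow N : inert_mtype N -> inert_ltype (arrow mt0 N)
with inert_mtype : mtype -> Prop :=
| inert_mset (M : mtype) : (forall L, L \in M -> inert_ltype L) -> inert_mtype M.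

Definition inert_tctx (Gamma : tctx) : Prop := forall x, inert_mtype (Gamma x).

Definition inert_derivation Gamma p M (pi : ptyping Gamma p M) : Prop :=
  inert_tctx Gamma /\ inert_mtype M.

Definition tight Gamma p M (pi : ptyping Gamma p M) : Prop :=
  inert_derivation pi /\ M = mt0.

(* Main.v *)
(** A step fires exactly one (@) rule of a derivation: right contexts never go
    under abstractions, so each subterm on the way to the redex is typed exactly
    once, and the abstraction of the redex has a singleton multi type.  Hence
    every step lowers the size of a derivation by exactly one, and evaluation
    terminates.  Its result is a program (f, E) with f a fireball.  In an inert
    context the head variable of an inert term x f_1 ... f_n has type
    [0 -o [0 -o ... M]], so that every f_j has type 0; by induction the size of
    the derivation is the size of the term, and the size of the context is that
    size plus the size of M.  The contribution of M cancels when the inert term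
    enters the environment. *)
Require Import Defs.
From mathcomp Require Import all_boot.
From mathcomp Require Import finmap multiset zify.

Set Implicit Arguments.
Unset Strict Implicit.
Unset Printing Implicit Defensive.

Local Open Scope mset_scope.
Local Open Scope nat_scope.

(** * Multisets *)

Section MultisetSplitting.
Variable K : choiceType.
Implicit Types (a : K) (A B P : {mset K}).

Lemma msetD_eq0 A B : A `+` B = mset0 -> A = mset0 /\ B = mset0.
Proof.
move=> /msetP AB0; split; apply/msetP => a; have := AB0 a; rewrite !msetE2 !mset0E; lia.
Qed.

Lemma mset1D_neq0 a P : a +` P <> mset0.
Proof. by move=> /msetP/(_ a); rewrite mset1DE eqxx mset0E. Qed.

Lemma mset1D_eq1 a b P : a +` P = [mset b] -> a = b /\ P = mset0.
Proof.
move=> aPb; have: a \in [mset b] by rewrite -aPb mset1D1.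
rewrite in_mset1 => /eqP eab; split=> //; apply: (can_inj (msetDKB [mset a])).
by rewrite msetD0 aPb eab.
Qed.

Lemma mset1D_eqD a P A B :
  a +` P = A `+` B ->
  (exists2 A', A = a +` A' & P = A' `+` B) \/
  (exists2 B', B = a +` B' & P = A `+` B').
Proof.
move=> aPAB; have: a \in A `+` B by rewrite -aPAB mset1D1.
rewrite in_msetD => /orP[] /msetB1K aE; [left; exists (A `\ a)|right; exists (B `\ a)] => //.
  by apply: (can_inj (msetDKB [mset a])); rewrite aPAB msetDA aE.
by apply: (can_inj (msetDKB [mset a])); rewrite aPAB msetDCA aE.
Qed.

End MultisetSplitting.

Lemma mtype_size0 : mtype_size mt0 = 0.
Proof. by rewrite /mtype_size enum_mset0 big_nil. Qed.

Lemma mtype_size1 L : mtype_size [mset L] = ltype_size L.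
Proof. by rewrite /mtype_size enum_msetn big_seq1. Qed.

Lemma mtype_sizeD (A B : mtype) :
  mtype_size (A `+` B) = mtype_size A + mtype_size B.
Proof.
rewrite /mtype_size -big_cat; apply: perm_big; apply/allP => L _ /=.
by rewrite count_cat !count_mem_mset msetE2.
Qed.

Lemma inert_mtypeD (A B : mtype) :
  inert_mtype (A `+` B) -> inert_mtype A /\ inert_mtype B.
Proof.
move=> iAB; inversion iAB as [C iC eC]; subst.
by split; constructor => L LM; apply: iC; rewrite in_msetD LM ?orbT.
Qed.

Lemma inert_mtype_arrow (M N : mtype) :
  inert_mtype [mset arrow M N] -> M = mt0 /\ inert_mtype N.
Proof.
move=> iMN; inversion iMN as [C iC eC]; subst.
have := iC _ (mset11 _); move eL: (arrow M N) => L iL.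
by case: iL eL => N' iN' /arrow_inj[-> ->].
Qed.

(** * Sized typing with contexts up to pointwise equality *)

(** Plain functions compared by [=1] let contexts be rearranged freely; finiteness of the domain
    returns only through [csupp]. *)
Definition ctx := nat -> mtype.
Implicit Types (G D H : ctx) (M N P : mtype).

Definition czero : ctx := fun=> mt0.
Definition cadd G D : ctx := fun x => G x `+` D x.
Definition csingle x M : ctx := fun y => if y == x then M else mt0.
Definition ccons M G : ctx := fun x => if x is y.+1 then G y else M.
Definition cdel k G : ctx := fun x => G (bump k x).
Definition cins0 k G : ctx := fun x => if x == k then mt0 else G (unbump k x).

(* [tp G t M n]: some derivation of G |- t : M has n rules (@).  The n-ary rule
   for abstractions is split into a nullary rule and a rule adding one premise,
   so that derivations for values can be split along a multiset sum. *)
Inductive tp : ctx -> term -> mtype -> nat -> Prop :=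
| tp_var G x M : G =1 csingle x M -> tp G (Var x) M 0
| tp_app H G D t u M N m n :
    tp G t [mset arrow M N] m -> tp D u M n -> H =1 cadd G D ->
    tp H (App t u) N (m + n).+1
| tp_lam0 G t : G =1 czero -> tp G (Lam t) mt0 0
| tp_lamS H G D t M N P m n :
    tp (ccons M G) t N m -> tp D (Lam t) P n -> H =1 cadd G D ->
    tp H (Lam t) (arrow M N +` P) (m + n).

Inductive ptp : ctx -> term -> seq term -> mtype -> nat -> Prop :=
| ptp_nil G t M n : tp G t M n -> ptp G t [::] M n
| ptp_rcons H G D t E i M N m n :
    ptp (ccons M G) t E N m -> tp D i M n -> H =1 cadd G D ->
    ptp H t (rcons E i) N (m + n).

Lemma tp_ext G H t M n : tp G t M n -> H =1 G -> tp H t M n.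
Proof.
by case=> *; [apply: tp_var|apply: tp_app; eauto|apply: tp_lam0|apply: tp_lamS; eauto];
   apply: ftrans; eauto.
Qed.

Lemma ptp_ext G H t E M n : ptp G t E M n -> H =1 G -> ptp H t E M n.
Proof.
by case=> *; [apply: ptp_nil; apply: tp_ext|apply: ptp_rcons; eauto; apply: ftrans]; eauto.
Qed.

(** Peeling off one premise at a time with [tp_lamS], down to [tp_lam0], recovers the n-ary rule for
    abstractions. *)
Lemma tp_lam_n t k (G : 'I_k -> ctx) (M N : 'I_k -> mtype) (n : 'I_k -> nat) :
  (forall j, tp (ccons (M j) (G j)) t (N j) (n j)) ->
  tp (fun x => \big[msetD/mt0]_(j < k) G j x) (Lam t)
     (\big[msetD/mt0]_(j < k) [mset arrow (M j) (N j)]) (\sum_(j < k) n j).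
Proof.
elim: k G M N n => [|k IH] G M N n tpj.
  by rewrite !big_ord0; apply: tp_lam0 => x; rewrite big_ord0.
rewrite !big_ord_recl; apply: (tp_lamS (tpj ord0)).
  by apply: (IH (fun j => G (lift ord0 j)) (fun j => M (lift ord0 j))) => j.
by move=> x; rewrite big_ord_recl.
Qed.

Lemma typing_tp Gamma t M (pi : typing Gamma t M) : tp Gamma t M (typing_size pi).
Proof.
elim: Gamma t M / pi => /=.
- by move=> x M; apply: tp_var => y; rewrite ctx1E.
- move=> Gamma Delta t u M N pit IHt piu IHu.
  by apply: tp_app IHt IHu _ => x; rewrite ctxDE.
- move=> k Gamma t M N pis IH.
  apply: (tp_ext (tp_lam_n (G := fun j => Gamma j) _)) => [j|x].
    by apply: tp_ext (IH j) _ => -[|x]; rewrite ctx_consE.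
  by apply: (big_morph (fun D : tctx => D x)) => [D1 D2|]; rewrite ?ctxDE ?ctx0E.
Qed.

Lemma ptyping_ptp Gamma p M (pi : ptyping Gamma p M) :
  ptp Gamma p.1 p.2 M (ptyping_size pi).
Proof.
elim: Gamma p M / pi => /= [Gamma t M pi|Gamma Delta t E i M N ppi IH pi].
  exact/ptp_nil/typing_tp.
apply: (ptp_rcons (G := Gamma)) (typing_tp pi) _ => [|x]; last by rewrite ctxDE.
by apply: ptp_ext IH _ => -[|x]; rewrite ctx_consE.
Qed.

(** * Typed values and substitution *)

Lemma tp_value0 v D M m : tp D v M m -> value v -> M = mt0 -> D =1 czero /\ m = 0.
Proof.
case=> {D v M m} [G x M eG _ M0|? ? ? ? ? ? ? ? ? ? ? ? vv|//|].
- by split=> // y; rewrite eG M0 /csingle if_same.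
- by inversion vv.
- by move=> ? ? ? ? ? ? ? ? ? _ _ _ _ /mset1D_neq0.
Qed.

(** A derivation for an abstraction has one premise per arrow of its type, and each premise follows
    its arrow into [A] or [B]. This lets a substituted value be distributed over the occurrences of
    its variable. *)
Lemma tp_value_split v D A B m :
  tp D v (A `+` B) m -> value v ->
  exists D1 D2 m1 m2, [/\ tp D1 v A m1, tp D2 v B m2, D =1 cadd D1 D2 & m = m1 + m2].
Proof.
move eM: (A `+` B : mtype) => M tpv; elim: tpv A B eM => {D v M m}.
- move=> G x M eG A B eM _; exists (csingle x A), (csingle x B), 0, 0.
  split=> [|||//]; try by apply: tp_var.
  by move=> y; rewrite eG -eM /cadd /csingle; case: eqP => //; rewrite msetD0.
- by move=> ? ? ? ? ? ? ? ? ? _ _ _ _ _ A B _ vv; inversion vv.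
- move=> G t eG A B /msetD_eq0[-> ->] _; exists czero, czero, 0, 0.
  by split=> [|||//]; try exact: tp_lam0; move=> x; rewrite eG /cadd msetD0.
- move=> H G D t M N P m n tpt _ _ IH eH A B /esym/mset1D_eqD[] [C -> eP] vv.
    have [D1 [D2 [m1 [m2 [tp1 tp2 eD ->]]]]] := IH _ _ (esym eP) vv.
    exists (cadd G D1), D2, (m + m1), m2; split=> //; last exact: addnA.
      exact: tp_lamS tpt tp1 _.
    by move=> x; rewrite eH /cadd eD msetDA.
  have [D1 [D2 [m1 [m2 [tp1 tp2 eD ->]]]]] := IH _ _ (esym eP) vv.
  exists D1, (cadd G D2), m1, (m + m2); split=> //; last exact: addnCA.
    exact: tp_lamS tpt tp2 _.
  by move=> x; rewrite eH /cadd eD msetDCA.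
Qed.

Lemma tp_shift k G t M n : tp G t M n -> tp (cins0 k G) (tshift k t) M n.
Proof.
move=> tpt; elim: tpt k => {G t M n} /=.
- move=> G x M eG k; apply: tp_var => y; rewrite /cins0 eG /csingle.
  case: (eqVneq y k) => [->|yk]; first by rewrite (negPf (neq_bump k x)).
  by rewrite -{2}(unbumpK yk) (inj_eq (can_inj (@bumpK k))).
- move=> H G D t u M N m n _ IHt _ IHu eH k; apply: (tp_app (IHt k) (IHu k)).
  by move=> x; rewrite /cins0 eH /cadd; case: ifP => //; rewrite msetD0.
- by move=> G t eG k; apply: tp_lam0 => x; rewrite /cins0 eG if_same.
- move=> H G D t M N P m n _ IHt _ IHl eH k.
  apply: (@tp_lamS _ (cins0 k G)) (IHl k) _.
    by apply: tp_ext (IHt k.+1) _ => -[|x]; rewrite // /cins0 eqSS unbumpS.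
  by move=> x; rewrite /cins0 eH /cadd; case: ifP => //; rewrite msetD0.
Qed.

Lemma value_shift k v : value v -> value (tshift k v).
Proof. by case=> *; constructor. Qed.

(** The axioms for the index [k] are replaced by parts of the derivation of [v], split along the
    multiset [H k]. Axioms count 0, so sizes simply add up. *)
Lemma tp_subst k H t N n v D m :
  tp H t N n -> value v -> tp D v (H k) m ->
  tp (cadd (cdel k H) D) (tsubst k v t) N (n + m).
Proof.
move=> tpt; elim: tpt k v D m => {H t N n} /=.
- move=> G x M eG k v D m vv; rewrite eG /csingle [k == x]eq_sym.
  case: eqVneq => xk tpv.
    apply: tp_ext tpv _ => y; rewrite /cadd /cdel eG /csingle xk.
    by rewrite eq_sym (negPf (neq_bump k y)) mset0D.
  (* Another variable gives [k] the type [mt0], so the erased value contributes neither context nor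
     size. *)
  have [D0 ->] := tp_value0 tpv vv erefl; apply: tp_var => y.
  rewrite /cadd /cdel D0 eG /csingle msetD0 -{1}(unbumpK xk).
  by rewrite (inj_eq (can_inj (@bumpK k))).
- move=> H G1 G2 t u M N n1 n2 _ IHt _ IHu eH k v D m vv; rewrite eH => tpv.
  have [D1 [D2 [m1 [m2 [tp1 tp2 eD ->]]]]] := tp_value_split tpv vv.
  rewrite addSn addnACA; apply: tp_app (IHt _ _ _ _ vv tp1) (IHu _ _ _ _ vv tp2) _.
  by move=> x; rewrite /cadd /cdel eH eD msetDACA.
- move=> G t eG k v D m vv; rewrite eG => tpv.
  have [D0 ->] := tp_value0 tpv vv erefl; apply: tp_lam0 => x.
  by rewrite /cadd /cdel eG D0 msetD0.
- move=> H G1 G2 t M N P n1 n2 _ IHt _ IHl eH k v D m vv; rewrite eH => tpv.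
  have [D1 [D2 [m1 [m2 [tp1 tp2 eD ->]]]]] := tp_value_split tpv vv.
  rewrite addnACA; apply: (@tp_lamS _ (cadd (cdel k G1) D1)) (IHl _ _ _ _ vv tp2) _.
    (* Shifting puts [mt0] at index 0, which leaves the type [M] of the bound variable intact. *)
    apply: tp_ext (IHt k.+1 _ _ _ (value_shift 0 vv) (tp_shift 0 tp1)) _ => -[|x].
      by rewrite /cadd /= msetD0.
    by rewrite /cadd /cdel bumpS /cins0 /= /unbump /= subn1.
  by move=> x; rewrite /cadd /cdel eH eD msetDACA.
Qed.

(** * Quantitative subject reduction *)

Lemma tp_appP H t u N n :
  tp H (App t u) N n ->
  exists G D M m1 m2,
    [/\ tp G t [mset arrow M N] m1, tp D u M m2, H =1 cadd G D & n = (m1 + m2).+1].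
Proof.
move=> tpa; inversion tpa as [|? G D ? ? M ? m1 m2|?|?]; subst.
by exists G, D, M, m1, m2.
Qed.

(** The singleton type forces exactly one premise on the abstraction; what remains has type [mt0],
    hence an empty context and size 0. *)
Lemma tp_redexP H t u N n :
  tp H (App (Lam t) u) N n ->
  exists G D M m1 m2,
    [/\ tp (ccons M G) t N m1, tp D u M m2, H =1 cadd G D & n = (m1 + m2).+1].
Proof.
move=> /tp_appP[G [D [M [m1 [m2 [tpl tpu eH ->]]]]]].
move eL: (Lam t) tpl => s; move eA: [mset arrow M N] => A tpl.
case: tpl eL eA eH => // {s A m1} [? ? _ _|].
  by rewrite -[X in X = _]msetD0 => /mset1D_neq0.
move=> G' G1 G2 s M1 N1 P n1 n2 tps tpP eG [et] /esym/mset1D_eq1[/arrow_inj[eM eN] P0] eH.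
subst; have [G20 ->] := tp_value0 tpP (value_lam s) erefl.
exists G1, D, M, n1, m2; split=> //; last by rewrite addn0.
by move=> x; rewrite eH /cadd eG /cadd G20 msetD0.
Qed.

Lemma tp_step_v C H t v N n :
  value v -> tp H (plug C (App (Lam t) v)) N n ->
  exists2 n', n = n'.+1 & tp H (plug C (tsubst 0 v t)) N n'.
Proof.
move=> vv; elim: C H N n => [|u C IH|C IH u] H N n /=.
- move=> /tp_redexP[G [D [M [m1 [m2 [tpt tpv eH ->]]]]]].
  exists (m1 + m2) => //; apply: tp_ext (tp_subst (k := 0) tpt vv tpv) _ => x.
  by rewrite eH.
- move=> /tp_appP[G [D [M [m1 [m2 [tpt /IH[m2' -> tpu] eH ->]]]]]].
  by exists (m1 + m2').+1; [rewrite addnS | apply: tp_app tpt tpu eH].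
- move=> /tp_appP[G [D [M [m1 [m2 [/IH[m1' -> tpt] tpu eH ->]]]]]].
  by exists (m1' + m2).+1; [rewrite addSn | apply: tp_app tpt tpu eH].
Qed.

Lemma cins0_0 G : cins0 0 G =1 ccons mt0 G.
Proof. by case=> [|x]; rewrite /cins0 //= /unbump subn1. Qed.

(** No substitution takes place: [M], the type of both the bound variable and [i], becomes the type
    of the new entry. The terms around the hole are shifted because the new variable does not occur
    in them. *)
Lemma tp_step_i C H t i N n :
  tp H (plug C (App (Lam t) i)) N n ->
  exists G D M m1 m2,
    [/\ tp (ccons M G) (plug (eshift 0 C) t) N m1, tp D i M m2, H =1 cadd G D
      & n = (m1 + m2).+1].
Proof.
elim: C H N n => [|u C IH|C IH u] H N n /=; first exact: tp_redexP.
- move=> /tp_appP[G [D [M [n1 [n2 [tpu /IH[G1 [D1 [M1 [m1 [m2 [tpt tpi eD ->]]]]]] eH ->]]]]]].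
  exists (cadd G G1), D1, M1, (n1 + m1).+1, m2; split=> //.
  + apply: tp_app (tp_shift 0 tpu) tpt _ => x.
    by rewrite /cadd cins0_0; case: x => [|x] //=; rewrite mset0D.
  + by move=> x; rewrite eH /cadd eD msetDA.
  + lia.
- move=> /tp_appP[G [D [M [n1 [n2 [/IH[G1 [D1 [M1 [m1 [m2 [tpt tpi eG ->]]]]]] tpu eH ->]]]]]].
  exists (cadd G1 D), D1, M1, (m1 + n2).+1, m2; split=> //.
  + apply: tp_app tpt (tp_shift 0 tpu) _ => x.
    by rewrite /cadd cins0_0; case: x => [|x] //=; rewrite msetD0.
  + by move=> x; rewrite eH /cadd eG msetDAC.
  + lia.
Qed.

(** [ptp] peels the environment from its right end, whereas a step acts on the term and the left
    end, so the induction reaches the bare term before anything changes. *)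
Lemma ptp_step H p q N n :
  ptp H p.1 p.2 N n -> step p q -> exists2 n', n = n'.+1 & ptp H q.1 q.2 N n'.
Proof.
move=> tpp pq; case: pq tpp => -[] C t u E _ /=.
  move=> vu; move es: (plug _ _) => s tps.
  elim: tps es => {H s E N n} [G s M n tps es|H G D s E i M N m n _ IH tpi eH es].
    rewrite -es in tps; have [n' -> tps'] := tp_step_v vu tps.
    by exists n' => //; apply: ptp_nil.
  by have [m' -> tps'] := IH es; exists (m' + n) => //; apply: ptp_rcons tps' tpi eH.
move=> _; move es: (plug _ _) => s tps.
elim: tps es => {H s E N n} [G s M n tps es|H G D s E i M N m n _ IH tpi eH es].
  rewrite -es in tps; have [G1 [D [M1 [m1 [m2 [tpt tpi eG ->]]]]]] := tp_step_i tps.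
  by exists (m1 + m2) => //; exact: (@ptp_rcons _ _ _ _ [::] _ _ _ _ _ (ptp_nil tpt) tpi eG).
have [m' -> tps'] := IH es; exists (m' + n) => //.
by rewrite -rcons_cons; apply: ptp_rcons tps' tpi eH.
Qed.

(** * Normal forms *)

Definition is_var t := if t is Var _ then true else false.
Definition is_value t := if t is App _ _ then false else true.

Fixpoint is_inert t :=
  if t is App t1 t2 then (is_var t1 || is_inert t1) && (is_value t2 || is_inert t2)
  else false.
Definition is_fireball t := is_value t || is_inert t.

Lemma valueP v : reflect (value v) (is_value v).
Proof. by case: v => *; constructor; [constructor|constructor|move=> v; inversion v]. Qed.

Scheme fireball_inert_ind := Minimality for fireball Sort Prop
  with inert_fireball_ind := Minimality for inert Sort Prop.

Lemma inert_is_inert i : inert i -> is_inert i.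
Proof.
apply: (@inert_fireball_ind (fun t => is_fireball t) (fun t => is_inert t)) => [v /valueP|j _|x f fs _ fb_f _ fb_fs].
- by rewrite /is_fireball => ->.
- by rewrite /is_fireball => ->; rewrite orbT.
elim/last_ind: fs fb_fs => [|fs g IH] fb_fs /=; first exact: fb_f.
rewrite foldl_rcons /= IH ?orbT /= => [|h h_fs]; apply: fb_fs; rewrite -cats1.
  by apply/List.in_or_app; right; left.
by apply/List.in_or_app; left.
Qed.

Lemma is_inert_inert i : is_inert i -> inert i.
Proof.
elim: i => //= t IHt u IHu /andP[t_vi u_vi].
have fb_u : fireball u.
  by case/orP: u_vi => [/valueP|/IHu]; [apply: fireball_value|apply: fireball_inert].
case/orP: t_vi => [|/IHt it].
  by case: t {IHt} => // x _; apply: (@inert_app x u [::]).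
case: it => x f fs fb_f fb_fs; rewrite -foldl_rcons; apply: inert_app fb_f _ => g.
by rewrite -cats1 => /List.in_app_iff[/fb_fs|[<-|[]]].
Qed.

Lemma is_fireball_fireball t : is_fireball t -> fireball t.
Proof.
by case/orP => [/valueP|/is_inert_inert]; [apply: fireball_value|apply: fireball_inert].
Qed.

(** Arguments are searched first, since a right context enters a function only once its argument is
    a fireball. A variable or inert term applied to a fireball is inert. *)
Lemma redex_or_fireball t :
  is_fireball t \/
  exists C s u, [/\ right_ctx C, is_fireball u & t = plug C (App (Lam s) u)].
Proof.
elim: t => [x|t _|t IHt u [fb_u|[C [s [w [rC fb_w ->]]]]]]; [by left|by left| |]; last first.
  by right; exists (AppR t C), s, w; split=> //; constructor.
case: IHt => [|[C [s [w [rC fb_w ->]]]]]; last first.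
  by right; exists (AppL C u), s, w; split=> //; constructor => //; apply: is_fireball_fireball.
case: t => [x _|s _|t1 t2 fb_t]; first by left.
  by right; exists Hole, s, u; split=> //; constructor.
by left; apply/andP; split; [exact: fb_t|exact: fb_u].
Qed.

Lemma step_or_fireball p : is_fireball p.1 \/ exists q, step p q.
Proof.
case: p => t E /=; case: (redex_or_fireball t) => [|[C [s [u [rC]]]]]; first by left.
case/orP => [/valueP vu|/is_inert_inert iu] ->; right.
  by eexists; left; apply: StepV.
by eexists; right; apply: StepI.
Qed.

(** An abstraction cannot head an inert term, and the failure propagates through every enclosing
    application. *)
Lemma plug_redex_not_fireball C t u : ~~ is_fireball (plug C (App (Lam t) u)).
Proof.
elim: C => [|s C IH|C IH s] //; rewrite {1}/is_fireball /= negb_and.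
  by rewrite IH orbT.
by move: IH => /norP[_ /negPf ->]; case: C.
Qed.

Lemma fireball_normal p : is_fireball p.1 -> normal p.
Proof. by move=> fb q [] st; case: st fb => C t u E _ _ /=; apply/negP/plug_redex_not_fireball. Qed.

Lemma step_is_program p q : is_program p -> step p q -> is_program q.
Proof.
move=> pp pq; case: pq pp => -[] C t u E _ iu pE //= j [<- //|]; exact: pE.
Qed.

(** * Inert derivations of fireballs *)

Definition inert_ctx G := forall x, inert_mtype (G x).
(** Under [csupp k] this is the full size of the context, as a bounded sum that is additive without
    comparing supports. *)
Definition csum k G := \sum_(x < k) mtype_size (G x).

Lemma csumD k H G D : H =1 cadd G D -> csum k H = csum k G + csum k D.
Proof. by move=> eH; rewrite -big_split; apply: eq_bigr => x _; rewrite eH mtype_sizeD. Qed.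

Lemma csum0 k G : G =1 czero -> csum k G = 0.
Proof. by move=> eG; rewrite /csum big1 // => x _; rewrite eG mtype_size0. Qed.

Lemma csum_single k G x M : x < k -> G =1 csingle x M -> csum k G = mtype_size M.
Proof.
move=> ltxk eG; rewrite /csum (bigD1 (Ordinal ltxk)) //= eG /csingle eqxx big1 ?addn0 //.
by move=> y /negPf; rewrite eG /csingle -val_eqE /= => ->; rewrite mtype_size0.
Qed.

Definition csupp k G := forall x, k <= x -> G x = mt0.

Lemma csuppD k H G D : H =1 cadd G D -> csupp k H -> csupp k G /\ csupp k D.
Proof.
by move=> eH sH; split=> x /sH; rewrite eH => /msetD_eq0[].
Qed.

Lemma inert_ctxD H G D : H =1 cadd G D -> inert_ctx H -> inert_ctx G /\ inert_ctx D.
Proof.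
by move=> eH iH; split=> x; have := iH x; rewrite eH => /inert_mtypeD[].
Qed.

Lemma csupp_single k G x L M : G =1 csingle x (L +` M) -> csupp k G -> x < k.
Proof.
move=> eG sG; rewrite ltnNge; apply/negP => /sG; rewrite eG /csingle eqxx.
exact: mset1D_neq0.
Qed.

Lemma tp_varP G x M n : tp G (Var x) M n -> G =1 csingle x M /\ n = 0.
Proof. by move=> tpx; inversion tpx; subst. Qed.

(** Along the spine each argument turns [[0 -o N]] into [N]; the size of the type drops by 1, which
    pays for the (@) rule. Keeping [M] arbitrary lets the induction pass through the heads. *)
Lemma tp_inert k H i M n :
  tp H i M n -> is_inert i -> inert_ctx H -> csupp k H ->
  [/\ inert_mtype M, n = term_size i & csum k H = n + mtype_size M].
Proof.
elim: i H M n => // t IHt u IHu H N n /tp_appP[G [D [M [m1 [m2 [tpt tpu eH ->]]]]]] /=.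
move=> /andP[t_vi u_vi] /(inert_ctxD eH)[iG iD] /(csuppD eH)[sG sD].
have [iM em1 eG] : [/\ inert_mtype [mset arrow M N], m1 = term_size t
    & csum k G = m1 + mtype_size [mset arrow M N]].
  case/orP: t_vi => [|it]; last exact: IHt.
  case: t tpt {IHt} => // x /tp_varP[eG ->] _; split=> //.
    by have := iG x; rewrite eG /csingle eqxx.
  (* The arrow makes the type of [x] non-empty, which puts [x] below the bound [k]. *)
  apply: csum_single (eG); apply: (@csupp_single _ _ _ (arrow M N) mt0) sG => y.
  by rewrite eG msetD0.
have [M0 iN] := inert_mtype_arrow iM; subst M.
have [em2 eD] : m2 = term_size u /\ csum k D = m2.
  case/orP: u_vi => [/valueP vu|iu]; last first.
    by have [_ -> ->] := IHu _ _ _ tpu iu iD sD; rewrite mtype_size0 addn0.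
  have [D0 ->] := tp_value0 tpu vu erefl; rewrite (csum0 k D0).
  by case: vu.
split=> //; first by rewrite em1 em2 addn1.
rewrite (csumD k eH) eG eD mtype_size1 ltype_size_arrow mtype_size0; lia.
Qed.

Lemma tp_fireball0 k H f n :
  tp H f mt0 n -> is_fireball f -> inert_ctx H -> csupp k H ->
  n = term_size f /\ csum k H = n.
Proof.
move=> tpf /orP[/valueP vf _ _|if_ iH sH].
  by have [H0 ->] := tp_value0 tpf vf erefl; rewrite (csum0 k H0); case: vf {tpf}.
by have [_ en ->] := tp_inert tpf if_ iH sH; rewrite mtype_size0 addn0.
Qed.

Lemma csum_cons k M G : csum k.+1 (ccons M G) = mtype_size M + csum k G.
Proof. by rewrite /csum big_ord_recl. Qed.

(* Extending the context by the type M of i adds |M| to its size, which is what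
   the context of i weighs beyond the size of i. *)
Lemma ptp_fireball0 k H t E n :
  ptp H t E mt0 n -> is_fireball t -> (forall i, List.In i E -> inert i) ->
  inert_ctx H -> csupp k H -> n = prog_size (t, E) /\ csum k H = n.
Proof.
move eN: mt0 => N tpp; elim: tpp eN k => {H t E N n}.
  move=> G t M n tpt M0 k fb _ iG sG; rewrite -M0 in tpt; rewrite /prog_size big_nil addn0.
  exact: tp_fireball0 tpt fb iG sG.
move=> H G D t E i M N m n _ IH tpi eH N0 k fb iE.
move=> /(inert_ctxD eH)[iG iD] /(csuppD eH)[sG sD].
have ii : inert i by apply: iE; rewrite -cats1; apply/List.in_or_app; right; left.
have [iM en eD] := tp_inert tpi (inert_is_inert ii) iD sD.
(* The type [M] of the entry is itself inert, so the extended context stays inert; the bound grows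
   by one for the new index 0. *)
have [|||em] := IH N0 k.+1 fb.
- by move=> j jE; apply: iE; rewrite -cats1; apply/List.in_or_app; left.
- by case.
- by case=> // x; apply: sG.
rewrite csum_cons => eG; split; last by rewrite (csumD k eH) eD; lia.
by rewrite em en /prog_size /= -cats1 big_cat big_seq1 addnA.
Qed.

(** * Evaluation of tightly typed programs *)

Lemma prog_size0_coerced q : is_program q -> prog_size q = 0 -> coerced_value q.
Proof.
case: q => t [|i E] pq; rewrite /prog_size /=.
  case: t pq => [x|t|t u] _; rewrite big_nil addn0; last by rewrite /= addn1.
    by exists (Var x); split; first by constructor.
  by exists (Lam t); split; first by constructor.
(* An inert term has positive size, so a program of size 0 has no entry. *)
have := inert_is_inert (pq i (or_introl erefl)).
by case: i {pq} => // s u _; rewrite big_cons /= addn1 addSn addnS.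
Qed.

(** Strong induction on the size: subject reduction lowers it and keeps context and type, so
    tightness persists until a fireball is reached. *)
Lemma tight_evaluation k n p H :
  ptp H p.1 p.2 mt0 n -> is_program p -> inert_ctx H -> csupp k H ->
  exists (q : prog) (d : evaluation p q),
    [/\ normal q, is_program q, n = eval_size d + prog_size q
      & n = eval_size d + csum k H].
Proof.
move=> + + iH sH; elim/ltn_ind: n p => n IH p tpp pp.
case: (step_or_fireball p) => [fb|[p' pp']].
  have [en eH] := ptp_fireball0 tpp fb pp iH sH.
  exists p, (eval_nil p); split=> //; first exact: fireball_normal.
have [n' en tpp'] := ptp_step tpp pp'; subst n.
have [q [d [nq pq en en']]] := IH _ (ltnSn n') _ tpp' (step_is_program pp pp').
by exists q, (eval_cons pp' d); split=> //=; rewrite addSn -?en -?en'.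
Qed.

Lemma ctx_size_csum (Gamma : tctx) :
  exists k, csupp k Gamma /\ csum k Gamma = ctx_size Gamma.
Proof.
(* One more than the largest index of the domain bounds it strictly. *)
exists (\max_(x <- finsupp Gamma) x).+1; split=> [x|].
  move=> ltx; apply: fsfun_dflt; apply/negP => xG; move: ltx; rewrite ltnNge => /negP[].
  by rewrite (big_rem x) //= leq_maxl.
set k := _.+1.
rewrite /csum /ctx_size -(big_mkord xpredT (fun x => mtype_size (Gamma x))).
rewrite (bigID (fun x => x \in finsupp Gamma)) /= [X in _ + X]big1 => [|x].
  rewrite addn0 -big_filter; apply: perm_big; apply: uniq_perm => [||x].
  - by rewrite filter_uniq ?iota_uniq.
  - exact: fset_uniq.
  rewrite mem_filter mem_index_iota andb_idr // => xG.
  by rewrite ltnS (big_rem x) //= leq_maxl.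
by move=> xG; rewrite fsfun_dflt ?mtype_size0.
Qed.

Theorem theorem4 (p : prog) (Gamma : tctx) (pi : ptyping Gamma p mt0) :
  is_program p -> tight pi ->
  exists (q : prog) (d : evaluation p q),
    normal q /\
    ptyping_size pi = eval_size d + prog_size q /\
    ptyping_size pi = eval_size d + ctx_size Gamma /\
    (finsupp Gamma = fset0 ->
       ptyping_size pi = eval_size d /\ coerced_value q).
Proof.
move=> pp [[iGamma _] _]; have [k [sG <-]] := ctx_size_csum Gamma.
have [q [d [nq pq en en']]] := tight_evaluation (ptyping_ptp pi) pp iGamma sG.
exists q, d; do 3!split=> //; move=> Gamma0.
have ctx_size0 : csum k Gamma = 0 by apply: csum0 => x; rewrite fsfun_dflt // Gamma0.
rewrite ctx_size0 addn0 in en'; split=> //; apply: prog_size0_coerced pq _.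
(* The two expressions for the size of the derivation now force [prog_size q] to be 0. *)
by apply: (@addnI (eval_size d)); rewrite addn0 -en.
Qed.
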